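(* For all integers $n\geq 3$ and $m\geq 3$, $$\hom(W_n,K_m^1)=m(m-2)\bigl[(m-2)^{n-1}+(-1)^n\bigr]-\sum_{k=1}^{n}v_{n,m}^k,\qquad v_{n,m}^k=v_{n,m}^{k,0}+v_{n,m}^{k,1},$$ where $$v_{n,m}^{k,0}=(m-2)\,t_{n,m-1}^k\qquad(1\leq k\leq n),$$ with $t_{n,m-1}^k$ as defined in the context, and, for $1\leq k\leq\lfloor n/2\rfloor$, $$\begin{aligned} v_{n,m}^{k,1}={}&2\sum_{\substack{1<i_1<i_2<\cdots<i_k=n\\ i_j-i_{j-1}>1}}(m-2)(m-3)^{i_1-2}\cdot\Biggl[\prod_{j=2}^k(m-2)(m-3)^{i_j-i_{j-1}-2}\Biggr]\\ &+2\sum_{\substack{1=i_1<i_2<\cdots<i_k<n\\ i_j-i_{j-1}>1}}\Biggl[\prod_{j=2}^k(m-2)(m-3)^{i_j-i_{j-1}-2}\Biggr]\cdot(m-2)(m-3)^{n-i_k-1}\\ &+2\sum_{\substack{1<i_1<i_2<\cdots<i_k<n\\ i_j-i_{j-1}>1}}(m-2)(m-3)^{i_1+n-i_k-2}\cdot\Biggl[\prod_{j=2}^k(m-2)(m-3)^{i_j-i_{j-1}-2}\Biggr], \end{aligned}$$ whereas $v_{n,m}^{k,1}=0$ for $\lfloor n/2\rfloor<k\leq n$. Here each sum is over integer sequences $(i_1,\dots,i_k)$ satisfying the displayed conditions (with $i_j-i_{j-1}>1$ required for all $2\leq j\leq k$).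
   Context: Graphs are finite and simple. A homomorphism from $G$ to $H$ is a map $f:V(G)\to V(H)$ sending edges to edges; $\hom(G,H)$ is the number of homomorphisms from $G$ to $H$. $K_m$ is the complete graph on $m$ vertices; the quasi-complete graph $K_m^1$ ($m\geq 3$) is obtained from $K_m$ by removing one edge. For $n\geq 3$, the wheel on $n$ spokes $W_n$ has vertices $0,1,\dots,n$ and edges $01,02,\dots,0n$ (spokes) and $12,23,\dots,(n-1)n,n1$. Empty products equal $1$, empty sums equal $0$, and $0^0=1$. The quantities $t_{n,m}^k$ (polynomial expressions in $m$, to be evaluated at $m-1$ in the claim): $t_{n,m}^n=2$ if $n$ is even, $t_{n,m}^n=0$ if $n$ is odd, $t_{n,m}^{n-1}=0$, and, for $1\leq k\leq n-2$, $$\begin{aligned} t_{n,m}^k={}&\sum_{\substack{0=i_1<i_2<\cdots<i_k=n-1\\ i_j-i_{j-1}\neq 2}}\Biggl[\prod_{\substack{2\leq j\leq k\\ i_j-i_{j-1}>2}}2\,p_{i_j-i_{j-1}-2}(m)\Biggr] +\sum_{\substack{0=i_1<i_2<\cdots<i_k<n-2\\ i_j-i_{j-1}\neq 2}}\Biggl[\prod_{\substack{2\leq j\leq k\\ i_j-i_{j-1}>2}}2\,p_{i_j-i_{j-1}-2}(m)\Biggr]\cdot 2\,p_{n-i_k-2}(m)\\ &+\sum_{\substack{1<i_1<i_2<\cdots<i_k=n-1\\ i_j-i_{j-1}\neq 2}}2\,p_{i_1-1}(m)\cdot\Biggl[\prod_{\substack{2\leq j\leq k\\ i_j-i_{j-1}>2}}2\,p_{i_j-i_{j-1}-2}(m)\Biggr]\\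 &+\sum_{\substack{0<i_1<i_2<\cdots<i_k<n-1\\ i_j-i_{j-1}\neq 2}}2\,p_{i_1+n-i_k-2}(m)\cdot\Biggl[\prod_{\substack{2\leq j\leq k\\ i_j-i_{j-1}>2}}2\,p_{i_j-i_{j-1}-2}(m)\Biggr], \end{aligned}$$ the sums being over integer sequences $(i_1,\dots,i_k)$ satisfying the displayed conditions, with $i_j-i_{j-1}\neq 2$ for all $2\leq j\leq k$. The polynomials $p_i(m)$. Put $p_0\equiv 1$. For $i\geq 1$ let $G_i$ be the directed graph with levels $1,\dots,i$, whose vertices are labelled $0$ or $1$; the first and the last level each consist of a single vertex, a $0$; each $0$ on a level $\leq i-2$ has one edge to a new $0$ and one edge to a new $1$ on the next level, each $1$ on a level $\leq i-2$ has exactly one edge, to a new $0$ on the next level, and each vertex on level $i-1$ has one edge to the bottom $0$ on level $i$ ($G_1$ is a single $0$; $G_2$ is two $0$'s joined by an edge). Thus the directed paths from top to bottom of $G_i$ correspond exactly to the sequences $w=(w_1,\dots,w_i)\in\{0,1\}^i$ with $w_1=w_i=0$ and no two consecutive $1$'s. Each such path contributes to $p_i$ the product of $i$ factors, one per level: the factor of level $1$ is $m-2$; for $r\geq 2$ the factor of level $r$ is $2$ if $w_r=1$, it is $m-2$ if $w_r=0$ and $w_{r-1}=1$, and it is $m-3$ if $w_r=w_{r-1}=0$. Then $p_i$ is the sum of these products over all such paths. For example $p_1=m-2$, $p_2=(m-2)(m-3)$, $p_3=(m-2)(m-3)^2+2(m-2)^2$. *)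

(* Defs.v *)
From HB Require Import structures.
From mathcomp Require Import all_boot all_order all_algebra.

Set Implicit Arguments.
Unset Strict Implicit.
Unset Printing Implicit Defensive.

Import Order.TTheory GRing.Theory Num.Theory.

Record sgraph := SGraph {
  vertex : finType;
  adj : rel vertex;
  adj_sym : symmetric adj;
  adj_irr : irreflexive adj }.

Definition is_hom (G H : sgraph) (f : {ffun vertex G -> vertex H}) : bool :=
  [forall x, forall y, adj x y ==> adj (f x) (f y)].

Definition hom_count (G H : sgraph) : nat :=
  #|[set f : {ffun vertex G -> vertex H} | is_hom f]|.

Definition edge_closure (T : eqType) (e : rel T) : rel T :=
  fun x y => (x != y) && (e x y || e y x).

Lemma edge_closure_sym (T : eqType) (e : rel T) :
  symmetric (edge_closure e).
Proof. by move=> x y; rewrite /edge_closure eq_sym orbC. Qed.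

Lemma edge_closure_irr (T : eqType) (e : rel T) :
  irreflexive (edge_closure e).
Proof. by move=> x; rewrite /edge_closure eqxx. Qed.

(* The simple graph on T whose edges are the unordered pairs xy with x != y and
   e x y or e y x. *)
Definition mkgraph (T : finType) (e : rel T) : sgraph :=
  SGraph (edge_closure_sym e) (edge_closure_irr e).

(* K_m^1: the complete graph on {0, ..., m-1} without the edge 01 (the choice
   of the removed edge is immaterial up to isomorphism). *)
Definition quasi_complete (m : nat) : sgraph :=
  mkgraph (fun x y : 'I_m => (x < y) && ((val x, val y) != (0, 1))).

Definition wheel (n : nat) : sgraph :=
  mkgraph (fun x y : 'I_n.+1 =>
    [|| (val x == 0) && (0 < y),
        (0 < x) && (val y == x.+1)
      | (val x == n) && (val y == 1)]).

(* Top-to-bottom paths of the digraph G_i, read as 0/1-words (true = 1). *)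
Definition admissible (w : seq bool) : bool :=
  [&& ~~ head false w, ~~ last false w
    & sorted (fun a b => ~~ (a && b)) w].

Local Open Scope ring_scope.

(* Factor of a level >= 2 labelled b whose predecessor is labelled a. *)
Definition level_factor (a b : bool) : {poly int} :=
  if b then 2 else if a then 'X - 2 else 'X - 3.

(* nth is 0-based: level r.+1 of the path w is nth false w r. *)
Definition p_poly (i : nat) : {poly int} :=
  if i is 0%N then 1 else
  \sum_(w : i.-tuple bool | admissible w)
     ('X - 2) *
     \prod_(1 <= r < i) level_factor (nth false w r.-1) (nth false w r).

(* \sum F i over the integer sequences i_1 < ... < i_k with values in [0, n],
   consecutive differences satisfying gap, and C i; the sequence is passed to C
   and F as a function i, with i j = i_j for 1 <= j <= k. *)
Definition seq_sum (n k : nat) (gap : pred nat) (C : pred (nat -> nat))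
    (F : (nat -> nat) -> int) : int :=
  \sum_(s : k.-tuple 'I_n.+1 |
     let i := fun j => nth 0%N (map val s) j.-1 in
     all (fun j => (i j.-1 < i j)%N && gap (i j - i j.-1)%N) (index_iota 2 k.+1)
     && C i)
   F (fun j => nth 0%N (map val s) j.-1).

Definition t_nk (n k : nat) (x : int) : int :=
  let gap d := (d != 2)%N in
  let P (i : nat -> nat) : int :=
    \prod_(2 <= j < k.+1 | (2 < i j - i j.-1)%N)
       (2 * (p_poly (i j - i j.-1 - 2)%N).[x]) in
  if k == n then (if odd n then 0 else 2)
  else if k == n.-1 then 0
  else
    seq_sum n k gap (fun i => (i 1 == 0) && (i k == n - 1))%N
      (fun i => P i)
  + seq_sum n k gap (fun i => (i 1 == 0) && (i k < n - 2))%N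
      (fun i => P i * (2 * (p_poly (n - i k - 2)%N).[x]))
  + seq_sum n k gap (fun i => (1 < i 1) && (i k == n - 1))%N
      (fun i => 2 * (p_poly (i 1 - 1)%N).[x] * P i)
  + seq_sum n k gap (fun i => (0 < i 1) && (i k < n - 1))%N
      (fun i => 2 * (p_poly (i 1 + n - i k - 2)%N).[x] * P i).

Definition v0_nk (n k : nat) (m : int) : int := (m - 2) * t_nk n k (m - 1).

(* The natural-number subtractions in the exponents never truncate under the
   range conditions, and 0 ^+ 0 = 1. *)
Definition v1_nk (n k : nat) (m : int) : int :=
  let gap d := (1 < d)%N in
  let P (i : nat -> nat) : int :=
    \prod_(2 <= j < k.+1) ((m - 2) * (m - 3) ^+ (i j - i j.-1 - 2)) in
  if (k <= n./2)%N then
    2 * seq_sum n k gap (fun i => (1 < i 1) && (i k == n))%N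
          (fun i => (m - 2) * (m - 3) ^+ (i 1 - 2) * P i)
  + 2 * seq_sum n k gap (fun i => (i 1 == 1) && (i k < n))%N
          (fun i => P i * ((m - 2) * (m - 3) ^+ (n - i k - 1)))
  + 2 * seq_sum n k gap (fun i => (1 < i 1) && (i k < n))%N
          (fun i => (m - 2) * (m - 3) ^+ (i 1 + n - i k - 2) * P i)
  else 0.

Definition v_nk (n k : nat) (m : int) : int := v0_nk n k m + v1_nk n k m.

(* Main.v *)
(* Fixing the hub colour c turns homomorphisms from the wheel into closed
   n-walks in the neighbourhood of c.  In K_m^1 every neighbourhood is an
   independent set of size p joined to a clique of size r, with (p, r) =
   (0, m - 2) if c is an end of the missing edge and (2, m - 3) otherwise; its
   closed walks are counted by a Lucas sequence with parameters r - 1 and p r.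

   On the other side, each inner sum of v_{n,m}^k runs over cyclic compositions
   of n into k gaps, weighted by a function g of the gaps.  With
   G = sum_e g(e) X^e it is the coefficient of X^n in X G' G^(k-1), so the sum
   over k is the coefficient of X G' / (1 - G), which is found by solving the
   linear recurrence X G' = T (1 - G). *)
Require Import Defs.
From HB Require Import structures.
From mathcomp Require Import all_boot all_order all_algebra.
From mathcomp Require Import ring zify.

Set Implicit Arguments.
Unset Strict Implicit.
Unset Printing Implicit Defensive.

Import Order.TTheory GRing.Theory Num.Theory.
Local Open Scope ring_scope.

(** * Weighted walks and sums over tuples *)

(** The [(x, y)] entry of the [k]-th power of the matrix [A]. *)
Fixpoint walk (R : comNzRingType) (T : finType) (A : T -> T -> R) (k : nat)
    (x y : T) : R :=
  if k is k'.+1 then \sum_z A x z * walk A k' z y else (x == y)%:R.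

Fixpoint path_weight (R : comNzRingType) (T : Type) (A : T -> T -> R) (x : T)
    (s : seq T) : R :=
  if s is y :: s' then A x y * path_weight A y s' else 1.

Lemma path_weight_nat (R : comNzRingType) (T : Type) (e : rel T) (x : T)
    (s : seq T) :
  path_weight (fun a b => (e a b)%:R : R) x s = (path e x s)%:R.
Proof. by elim: s x => //= y s IHs x; rewrite IHs -mulnb natrM. Qed.

Lemma prod_nth_path_weight (R : comNzRingType) (T : Type) (A : T -> T -> R)
    (x0 x : T) (s : seq T) :
  \prod_(1 <= r < (size s).+1) A (nth x0 (x :: s) r.-1) (nth x0 (x :: s) r) =
  path_weight A x s.
Proof.
elim: s x => [|y s IHs] x; first by rewrite big_geq.
rewrite big_nat_recl //= -IHs; congr (_ * _).
by rewrite [RHS]big_add1 /= big_add1; apply: eq_bigr => -[|r].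
Qed.

Lemma sum_tuple_cons (R : comNzRingType) (T : finType) (k : nat)
    (phi : seq T -> R) :
  \sum_(t : k.+1.-tuple T) phi t =
  \sum_x \sum_(s : k.-tuple T) phi (x :: s).
Proof.
rewrite pair_big (reindex (fun p : T * k.-tuple T => [tuple of p.1 :: p.2])) //.
exists (fun t => (thead t, [tuple of behead t])) => /= [[x s] _|t _] /=.
  by congr (_, _); apply: val_inj.
by rewrite -tuple_eta.
Qed.

(** Transfer-matrix expansion of a matrix power; [phi] leaves the end point free, so that conditions
    on the last entry can be imposed. *)
Lemma sum_path_weight (R : comNzRingType) (T : finType) (A : T -> T -> R)
    (k : nat) (x : T) (phi : T -> R) :
  \sum_(s : k.-tuple T) path_weight A x s * phi (last x s) =
  \sum_y walk A k x y * phi y.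
Proof.
elim: k x => [|k IHk] x.
  rewrite (big_pred1 [tuple]) => [|t]; last by rewrite [t]tuple0 /= eqxx.
  rewrite (bigD1 x) //= eqxx big1 ?addr0 // => y.
  by rewrite eq_sym => /negbTE->; rewrite mul0r.
rewrite (sum_tuple_cons _ (fun s => path_weight A x s * phi (last x s))) /=.
under [RHS]eq_bigr do rewrite mulr_suml.
rewrite [RHS]exchange_big; apply: eq_bigr => z _ /=.
under [LHS]eq_bigr do rewrite -mulrA.
rewrite -mulr_sumr IHk mulr_sumr.
by apply: eq_bigr => y _; rewrite mulrA.
Qed.

Lemma sum_closed_path_weight (R : comNzRingType) (T : finType)
    (A : T -> T -> R) (k : nat) (x y : T) :
  \sum_(s : k.-tuple T) path_weight A x (rcons s y) = walk A k.+1 x y.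
Proof.
elim: k x => [|k IHk] x.
  rewrite (big_pred1 [tuple]) => [|t]; last by rewrite [t]tuple0 /= eqxx.
  rewrite /= (bigD1 y) //= eqxx big1 ?addr0 // => z /negbTE->.
  by rewrite mulr0.
rewrite (sum_tuple_cons _ (fun s => path_weight A x (rcons s y))) /=.
by apply: eq_bigr => z _; rewrite -mulr_sumr IHk.
Qed.

(** * Homomorphisms from a wheel as closed walks *)

(** The relation tests a spoke only at the end [b] of a step. Each rim vertex ends exactly one step
    of the closed walk, so every spoke is tested; the final step to [x] is the rim edge back to
    vertex 1. *)
Lemma is_hom_wheel (k : nat) (H : sgraph) (c x : vertex H) (s : seq (vertex H))
    (f : {ffun vertex (wheel k.+1) -> vertex H}) :
  (1 < k)%N -> size s = k ->
  (forall i : 'I_k.+2, f i = nth c [:: c, x & s] i) ->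
  is_hom f = path (fun a b => adj c b && adj a b) x (rcons s x).
Proof.
move=> k_gt1 sz_s fE; apply/idP/idP => [/forallP hom_f | /(pathP c) path_f].
  have {}hom_f (i j : nat) : (i < k.+2)%N -> (j < k.+2)%N -> (i != j) ->
      [|| (i == 0) && (0 < j), (0 < i) && (j == i.+1)
        | (i == k.+1) && (j == 1)]%N ->
      adj (nth c [:: c, x & s] i) (nth c [:: c, x & s] j).
    move=> lti ltj neq_ij eij; have /forallP/(_ (Ordinal ltj)) := hom_f (Ordinal lti).
    rewrite !fE => /implyP; apply.
    by rewrite /= /edge_closure /= -val_eqE /= neq_ij eij.
  apply/(pathP c) => i; rewrite size_rcons sz_s ltnS leq_eqVlt.
  case/predU1P => [->|lt_ik].
    have -> : nth c (rcons s x) k = x by rewrite -sz_s nth_rcons ltnn eqxx.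
    have := hom_f 0%N 1%N isT isT isT isT; rewrite /= => ->.
    have -> : nth c (x :: rcons s x) k = nth c (x :: s) k.
      by rewrite -rcons_cons nth_rcons /= sz_s ltnSn.
    by have := hom_f k.+1 1%N (ltnSn _) isT; apply=> /=; lia.
  have := hom_f 0%N i.+2 isT lt_ik isT isT; rewrite /= nth_rcons sz_s lt_ik => ->.
  have -> : nth c (x :: rcons s x) i = nth c (x :: s) i.
    by rewrite -rcons_cons nth_rcons /= sz_s ltnS ltnW.
  by have := hom_f i.+1 i.+2 (ltnW lt_ik) lt_ik; apply=> /=; lia.
have step i : (i < k)%N -> adj c (nth c s i) && adj (nth c (x :: s) i) (nth c s i).
  move=> lt_ik; have := path_f i; rewrite size_rcons sz_s ltnW ?ltnS // => /(_ isT).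
  by rewrite -rcons_cons !nth_rcons /= sz_s lt_ik ltnS ltnW.
have close : adj c x && adj (nth c (x :: s) k) x.
  have := path_f k; rewrite size_rcons sz_s ltnSn => /(_ isT).
  by rewrite -rcons_cons !nth_rcons /= sz_s ltnSn ltnn eqxx.
have edge (i j : nat) : (i < k.+2)%N -> (j < k.+2)%N ->
    [|| (i == 0) && (0 < j), (0 < i) && (j == i.+1)
      | (i == k.+1) && (j == 1)]%N ->
    adj (nth c [:: c, x & s] i) (nth c [:: c, x & s] j).
  move=> lti ltj /or3P[] /andP[].
  - move=> /eqP->; case: j ltj => [//|[|j]] ltj _ /=; first by case/andP: close.
    by case/andP: (step j ltj).
  - case: i lti => // i _ _ /eqP j_i; rewrite j_i in ltj *.
    by case/andP: (step i ltj).
  - by move=> /eqP-> /eqP->; case/andP: close.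
apply/forallP => i; apply/forallP => j; apply/implyP; rewrite !fE.
rewrite /= /edge_closure => /andP[_ /orP[]] /edge; first exact.
by rewrite adj_sym; apply.
Qed.

Lemma hom_count_wheel (n : nat) (H : sgraph) : (2 < n)%N ->
  (hom_count (wheel n) H)%:Z =
  \sum_(c : vertex H) \sum_(x : vertex H)
     walk (fun a b => (adj c b && adj a b)%:R : int) n x x.
Proof.
case: n => // k k_gt1; rewrite /hom_count -sum1_card -natz natr_sum big_mkcond /=.
pose h (t : k.+2.-tuple (vertex H)) : {ffun vertex (wheel k.+1) -> vertex H} :=
  [ffun i => tnth t i].
rewrite (reindex h) /=; last first.
  exists (fun f => [tuple f i | i < k.+2]) => [t _|f _].
    by apply: eq_from_tnth => i; rewrite tnth_mktuple ffunE.
  by apply/ffunP => i; rewrite ffunE tnth_mktuple.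
pose e c := [rel a b : vertex H | adj c b && adj a b].
(* [sum_tuple_cons] needs a function of all sequences; the value 0 on sequences shorter than 2 never
   enters. *)
pose phi s := if s is c :: x :: s' then (path (e c) x (rcons s' x))%:R else 0 : int.
transitivity (\sum_(t : k.+2.-tuple (vertex H)) phi t).
  apply: eq_bigr; case=> -[|c [|x s]] //= sz_t _.
  rewrite inE (@is_hom_wheel k H c x s) //; last first.
  - by move=> i; rewrite ffunE (tnth_nth c).
  - by move: sz_t => /eqP[].
  by case: path.
rewrite sum_tuple_cons; apply: eq_bigr => c _.
rewrite (sum_tuple_cons _ (fun s => phi (c :: s))) /=; apply: eq_bigr => x _.
rewrite -[RHS]sum_closed_path_weight; apply: eq_bigr => s _.
by rewrite path_weight_nat.
Qed.

(** * Lucas sequences and closed walks in the neighbourhoods of colours *)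

(** The Lucas sequence of the first kind with characteristic polynomial [X^2 - a X - b]. *)
Fixpoint lucas (R : comNzRingType) (a b : R) (n : nat) : R :=
  match n with
  | 0 => 0
  | 1 => 1
  | (n'.+1 as n1).+1 => a * lucas a b n1 + b * lucas a b n'
  end.

Lemma lucasSS (R : comNzRingType) (a b : R) (n : nat) :
  lucas a b n.+2 = a * lucas a b n.+1 + b * lucas a b n.
Proof. by []. Qed.

Lemma walkS (R : comNzRingType) (T : finType) (A : T -> T -> R) (k : nat)
    (x y : T) :
  walk A k.+1 x y = \sum_z A x z * walk A k z y.
Proof. by []. Qed.

Lemma walk_col0 (R : comNzRingType) (T : finType) (A : T -> T -> R) (n : nat)
    (x y : T) :
  (forall z, A z y = 0) -> walk A n.+1 x y = 0.
Proof.
move=> Ay0; elim: n x => [|n IHn] x.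
  rewrite /= big1 // => z _; case: eqVneq => [->|_]; last by rewrite mulr0.
  by rewrite Ay0 mul0r.
by rewrite walkS big1 // => z _; rewrite IHn mulr0.
Qed.

(* A is the adjacency matrix of an independent set P joined to a clique Q,
   extended by zero columns. *)
Lemma sum_closed_walk_split (R : comNzRingType) (T : finType)
    (A : T -> T -> R) (P Q : {set T}) (n : nat) :
  [disjoint P & Q] ->
  (forall a b, a \in P -> A a b = (b \in Q)%:R) ->
  (forall a b, a \in Q -> A a b = ((b \in P :|: Q) && (b != a))%:R) ->
  (forall a b, b \notin P :|: Q -> A a b = 0) ->
  let p := #|P|%:R in let r := #|Q|%:R in
  let u := lucas (r - 1) (p * r) in
  \sum_x walk A n.+1 x x = p * r * u n + u n.+2 - (r - 1) * (-1) ^+ n.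
Proof.
move=> disPQ AP AQ A0 p r u.
(* Column sums of the [k]-th power. All rows in [P] coincide, and a row in [Q] is the indicator of
   [P :|: Q] minus a unit vector, so these sums satisfy a 2 by 2 linear recursion. *)
pose SP k y := \sum_(x in P) walk A k x y.
pose SQ k y := \sum_(x in Q) walk A k x y.
have walkP k x y : x \in P -> walk A k.+1 x y = SQ k y.
  move=> Px; rewrite /SQ [RHS]big_mkcond /=; apply: eq_bigr => z _.
  by rewrite AP //; case: (z \in Q); rewrite ?mul1r ?mul0r.
have walkQ k x y : x \in Q -> walk A k.+1 x y = SP k y + SQ k y - walk A k x y.
  move=> Qx; rewrite /SP /SQ -bigU //= [X in _ = X - _](bigD1 x) /=; last first.
    by rewrite inE Qx orbT.
  rewrite [RHS]addrAC subrr add0r [RHS]big_mkcond /=; apply: eq_bigr => z _.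
  by rewrite AQ // !inE; case: (_ && _); rewrite ?mul1r ?mul0r.
have SPS k y : SP k.+1 y = p * SQ k y.
  rewrite /SP (eq_bigr (fun=> SQ k y)) => [|x]; last exact: walkP.
  by rewrite sumr_const -mulr_natl.
have SQS k y : SQ k.+1 y = r * SP k y + (r - 1) * SQ k y.
  rewrite {1}/SQ (eq_bigr (fun x => SP k y + SQ k y - walk A k x y)) => [|x];
    last exact: walkQ.
  rewrite sumrB sumr_const -mulr_natl -/(SQ k y) -/r; ring.
have delta (S : {set T}) y : \sum_(x in S) walk A 0 x y = (y \in S)%:R.
  have [Sy|Sy] := boolP (y \in S).
    by rewrite (bigD1 y) //= eqxx big1 ?addr0 // => z /andP[_ /negbTE->].
  by rewrite big1 // => z Sz /=; case: eqVneq => // zy; rewrite -zy Sz in Sy.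
(* The recursion has the characteristic polynomial [X^2 - (r - 1) X - p r] of [u]; [(SP, SQ)] starts
   at (1, 0) for [y] in [P] and at (0, 1) for [y] in [Q]. *)
have solP k y : y \in P -> SQ k y = r * u k /\ SP k y = u k.+1 - (r - 1) * u k.
  move=> Py; elim: k => [|k [IHQ IHP]].
    rewrite /SP /SQ !delta Py (disjointFr disPQ Py) /u /=; split; ring.
  rewrite SPS SQS IHQ IHP /u lucasSS; split; ring.
have solQ k y : y \in Q -> SQ k y = u k.+1 /\ SP k y = p * u k.
  move=> Qy; elim: k => [|k [IHQ IHP]].
    rewrite /SP /SQ !delta Qy (disjointFl disPQ Qy) /u /=; split; ring.
  rewrite SPS SQS IHQ IHP /u lucasSS; split; ring.
have traceP k : \sum_(x in P) walk A k.+1 x x = p * r * u k.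
  rewrite (eq_bigr (fun=> r * u k)) => [|x Px]; last first.
    by rewrite walkP //; case: (solP k x Px).
  by rewrite sumr_const -mulr_natl mulrA.
(* By [walkQ], the trace at [k + 1] is [u (k + 2) + u (k + 1)] minus the trace at [k]; the initial
   trace [r = (r - 1) + u 1] leaves the alternating term. *)
have traceQ k : \sum_(x in Q) walk A k x x = (r - 1) * (-1) ^+ k + u k.+1.
  elim: k => [|k IHk].
    rewrite (eq_bigr (fun=> 1)) => [|x _]; last by rewrite /= eqxx.
    by rewrite sumr_const -/r expr0 /u /=; ring.
  rewrite (eq_bigr (fun x => p * u k + u k.+1 - walk A k x x)) => [|x Qx]; last first.
    by rewrite walkQ //; case: (solQ k x Qx) => -> ->.
  rewrite sumrB sumr_const -mulr_natl -/r IHk /u lucasSS exprS; ring.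
have -> : \sum_x walk A n.+1 x x = \sum_(x in [predU P & Q]) walk A n.+1 x x.
  rewrite [RHS]big_mkcond; apply: eq_bigr => x _; case: ifPn => // nPQx.
  by apply: walk_col0 => z; apply: A0; rewrite in_setU.
rewrite bigU // traceP traceQ exprS /=; ring.
Qed.

Lemma adj_quasi_complete (m : nat) (a b : 'I_m) :
  @adj (quasi_complete m) a b = (a != b) && ~~ ((a < 2)%N && (b < 2)%N).
Proof.
rewrite /= /edge_closure /= -val_eqE /= !xpair_eqE.
case: a b => [a lta] [b ltb] /=; lia.
Qed.

(** Each end of the missing edge sees a clique of size [m + 1]; each of the other [m + 1] colours
    sees both ends and a clique of size [m]. *)
Lemma hom_count_wheel_quasi_complete (n m : nat) : (2 < n.+1)%N ->
  let u p r : nat -> int := lucas (r - 1) (p * r) in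
  let s : int := m%:Z + 1 in
  (hom_count (wheel n.+1) (quasi_complete m.+3))%:Z =
    2 * (u 0 s n.+2 - (s - 1) * (-1) ^+ n)
    + s * (2 * m%:Z * u 2 m%:Z n + u 2 m%:Z n.+2 - (m%:Z - 1) * (-1) ^+ n).
Proof.
move=> n_gt1 u s; rewrite hom_count_wheel //.
change (\sum_(c < m.+3) \sum_(x < m.+3) walk (fun a b : 'I_m.+3 =>
  (@adj (quasi_complete m.+3) c b && @adj (quasi_complete m.+3) a b)%:R : int)
  n.+1 x x = 2 * (u 0 s n.+2 - (s - 1) * (-1) ^+ n)
    + s * (2 * m%:Z * u 2 m%:Z n + u 2 m%:Z n.+2 - (m%:Z - 1) * (-1) ^+ n)).
pose P : {set 'I_m.+3} := [set ord0; lift ord0 ord0].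
have inP x : (x \in P) = (x < 2)%N.
  by rewrite !inE -!val_eqE /= /bump; case: x => x /= _; lia.
have cardP : #|P| = 2 by rewrite cards2.
have cardCP : #|~: P| = m.+1 by have := cardsC P; rewrite cardP card_ord; lia.
rewrite (bigID (mem P)); congr (_ + _).
  rewrite (eq_bigr (fun=> u 0 s n.+2 - (s - 1) * (-1) ^+ n)) => [|c Pc].
    by rewrite sumr_const cardP mulr_natl.
  have c2 : (c < 2)%N by rewrite -inP.
  have -> := @sum_closed_walk_split _ _ _ set0 (~: P) n.
  - by rewrite cards0 cardCP mulr0n !mul0r add0r /u /s !mul0r -natr1 natz.
  - by rewrite -setI_eq0 set0I.
  - by move=> a b; rewrite inE.
  - move=> a b; rewrite !adj_quasi_complete set0U !in_setC !inP => a2.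
    by congr (_%:R); rewrite -!val_eqE /=; lia.
  - move=> a b; rewrite set0U in_setC negbK !inP => b2.
    by rewrite !adj_quasi_complete c2 b2 andbF.
rewrite (eq_bigr (fun=> 2 * m%:Z * u 2 m%:Z n + u 2 m%:Z n.+2
                        - (m%:Z - 1) * (-1) ^+ n)) => [|c Pc].
  rewrite sumr_const -[LHS]mulr_natl; congr (_ * _).
  have -> : #|[pred x | x \notin P]| = m.+1.
    by rewrite -[RHS]cardCP; apply: eq_card => x; rewrite in_setC.
  by rewrite -natr1 natz.
have c2 : ~~ (c < 2)%N by rewrite -inP.
have cardQ : #|(~: P) :\ c| = m.
  by have := cardsD1 c (~: P); rewrite cardCP in_setC (_ : c \notin P) // => -[].
have -> := @sum_closed_walk_split _ _ _ P (~: P :\ c) n.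
- by rewrite cardP cardQ (natz m).
- rewrite -setI_eq0; apply/eqP/setP => x.
  by rewrite in_setI in_setD1 in_setC in_set0; case: (x \in P); rewrite ?andbF.
- move=> a b; rewrite !adj_quasi_complete in_setD1 in_setC !inP => a2.
  by congr (_%:R); rewrite -!val_eqE /=; lia.
- move=> a b; rewrite !adj_quasi_complete in_setU !in_setD1 !in_setC !inP => /andP[ac a2].
  by congr (_%:R); move: ac; rewrite -!val_eqE /=; lia.
- move=> a b; rewrite in_setU in_setD1 in_setC !inP !adj_quasi_complete => Pb.
  apply/eqP; rewrite pnatr_eq0; move: Pb.
  by rewrite -!val_eqE /=; lia.
Qed.

(** * The polynomials [p_i] as Lucas sequences *)

(** Weight 0 on the pair 11 turns admissibility into a matrix entry. The prefixed [false] is level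
    1. *)
Lemma admissible_path_weight (w : seq bool) (x : int) :
  (if path (fun a b => ~~ (a && b)) false w then
     \prod_(1 <= r < (size w).+1)
        (level_factor (nth false (false :: w) r.-1) (nth false (false :: w) r)).[x]
   else 0) =
  path_weight (fun a b => if a && b then 0 else (level_factor a b).[x]) false w.
Proof.
rewrite (prod_nth_path_weight (fun a b => (level_factor a b).[x])).
elim: w false => [|b w IHw] a //=.
by case: (a && b) => /=; rewrite ?mul0r // -IHw; case: path; rewrite ?mulr0.
Qed.

(** The transfer matrix between levels has rows [(x - 3, 2)] and [(x - 2, 0)], hence characteristic
    polynomial [X^2 - (x - 3) X - 2 (x - 2)]. At [x = r + 2] this gives the Lucas sequence of a
    neighbourhood with [p = 2] and clique size [r]. *)
Lemma horner_p_poly (i : nat) (x : int) :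
  (p_poly i.+1).[x] = (x - 2) * lucas (x - 3) (2 * (x - 2)) i.+1.
Proof.
pose A a b := if a && b then 0 else (level_factor a b).[x].
have -> : (p_poly i.+1).[x] = (x - 2) * walk A i false false.
  rewrite horner_sum big_mkcond /=.
  pose phi w := if admissible w then
    (('X - 2) * \prod_(1 <= r < i.+1) level_factor (nth false w r.-1) (nth false w r)).[x]
    else 0.
  rewrite (sum_tuple_cons _ phi) big_bool /= [X in X + _]big1 ?add0r => [|w _]; last first.
    by [].
  transitivity (\sum_(w : i.-tuple bool)
      (x - 2) * (path_weight A false w * (last false w == false)%:R)).
    apply: eq_bigr => w _; rewrite -admissible_path_weight size_tuple /phi /admissible /=.
    case: last => /=; rewrite ?mulr0 // mulr1; case: path; rewrite ?mulr0 //.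
    by rewrite hornerM horner_prod !hornerE.
  rewrite -mulr_sumr (sum_path_weight A i false (fun y => (y == false)%:R)) big_bool.
  by rewrite /= mulr0 add0r mulr1.
congr (_ * _).
have [] : walk A i false false = lucas (x - 3) (2 * (x - 2)) i.+1 /\
  walk A i true false = (x - 2) * lucas (x - 3) (2 * (x - 2)) i; last by [].
elim: i => [|i [IHf IHt]]; first by rewrite /= mulr0.
rewrite !walkS !big_bool IHf IHt lucasSS.
move: (lucas _ _ i.+1) (lucas _ _ i) => u1 u0.
have hornern k : (k%:R : {poly int}).[x] = k%:R.
  by rewrite -polyC_natr hornerC.
rewrite /A /level_factor /= !(hornern, hornerD, hornerN, hornerX) /=.
by split; ring.
Qed.

(** * Sums over increasing sequences and powers of the gap polynomial *)

Lemma path_weight_map (R : comNzRingType) (T U : Type) (h : T -> U)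
    (A : U -> U -> R) (x : T) (s : seq T) :
  path_weight A (h x) (map h s) = path_weight (fun a b => A (h a) (h b)) x s.
Proof. by elim: s x => //= y s IHs x; rewrite IHs. Qed.

Lemma prod_if_all (R : comNzRingType) (I : Type) (P : pred I) (F : I -> R)
    (s : seq I) :
  \prod_(i <- s) (if P i then F i else 0) =
  if all P s then \prod_(i <- s) F i else 0.
Proof.
elim: s => [|i s IHs]; first by rewrite !big_nil.
rewrite !big_cons IHs /=.
by case: (P i); case: (all P s); rewrite ?mul0r ?mulr0.
Qed.

Definition gap_weight (R : comNzRingType) (g : nat -> R) (a b : nat) : R :=
  if (a <= b)%N then g (b - a)%N else 0.

(** Increasing sequences with permitted gaps are walks for the matrix [gap_weight g], where [g]
    vanishes on forbidden gaps. Since [c] and [phi] involve only the two end entries, they stay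
    outside the walk. *)
Lemma seq_sum_walk (n k : nat) (gap : pred nat) (c : nat -> nat -> bool)
    (phi : nat -> nat -> int) (wt g : nat -> int)
    (C : pred (nat -> nat)) (F : (nat -> nat) -> int) :
  (forall d, g d = if (0 < d)%N && gap d then wt d else 0) ->
  (forall i, C i = c (i 1%N) (i k.+1)) ->
  (forall i, F i = phi (i 1%N) (i k.+1) *
                   \prod_(2 <= j < k.+2) wt (i j - i j.-1)%N) ->
  seq_sum n k.+1 gap C F =
  \sum_(a < n.+1) \sum_(b < n.+1) (if c a b then phi a b else 0) *
     walk (fun a b : 'I_n.+1 => gap_weight g a b) k a b.
Proof.
move=> gE CE FE; rewrite /seq_sum big_mkcond /=.
pose psi (s : seq 'I_n.+1) := let i := fun j => nth 0%N (map val s) j.-1 in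
  if all (fun j => (i j.-1 < i j)%N && gap (i j - i j.-1)%N) (index_iota 2 k.+2)
     && C i
  then F i else 0.
rewrite (sum_tuple_cons k psi); apply: eq_bigr => a _.
under [RHS]eq_bigr do rewrite mulrC.
rewrite -(sum_path_weight _ k a (fun b : 'I_n.+1 => if c a b then phi a b else 0)).
apply: eq_bigr => s _; pose i j := nth 0%N (map val (a :: s)) j.-1.
have i1 : i 1%N = a by [].
have ik : i k.+1 = last a s.
  by rewrite -[RHS](last_map val) (last_nth 0%N) size_map size_tuple.
have -> : psi (a :: s) =
    if all (fun j => (i j.-1 < i j)%N && gap (i j - i j.-1)%N)
         (index_iota 2 k.+2) && c a (last a s)
    then phi a (last a s) * \prod_(2 <= j < k.+2) wt (i j - i j.-1)%N else 0.
  by rewrite -ik -i1 -(FE i) -(CE i).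
rewrite -(path_weight_map (fun x : 'I_n.+1 => x : nat) (gap_weight g)).
rewrite -(prod_nth_path_weight _ 0%N) size_map size_tuple.
have -> : \prod_(1 <= r < k.+1)
    gap_weight g (nth 0%N (map val (a :: s)) r.-1) (nth 0%N (map val (a :: s)) r) =
  \prod_(2 <= j < k.+2) (if (i j.-1 < i j)%N && gap (i j - i j.-1)%N
                        then wt (i j - i j.-1)%N else 0).
  rewrite [RHS]big_add1; apply: eq_bigr => r _; rewrite /gap_weight /i /= gE subn_gt0.
  by case: ltngtP => // ->; rewrite subnn ltnn.
by rewrite prod_if_all; case: (all _ _); case: (c _ _) => /=; rewrite ?mulr0 ?mul0r // mulrC.
Qed.

Definition gap_poly (R : comNzRingType) (n : nat) (g : nat -> R) : {poly R} :=
  \poly_(e < n.+1) g e.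

(** The matrix is upper triangular Toeplitz, so its powers follow those of the polynomial;
    truncation at degree [n] is harmless because [b - a <= n]. *)
Lemma walk_gap_weight (R : comNzRingType) (n : nat) (g : nat -> R) (k : nat)
    (a b : 'I_n.+1) :
  walk (fun a b : 'I_n.+1 => gap_weight g a b) k a b =
  if (a <= b)%N then (gap_poly n g ^+ k)`_(b - a) else 0.
Proof.
elim: k a => [|k IHk] a.
  rewrite /= expr0 coef1 subn_eq0 -val_eqE /=.
  by case: ltngtP.
rewrite walkS; under eq_bigr do rewrite IHk.
pose F z := gap_weight g a z * (if (z <= b)%N then (gap_poly n g ^+ k)`_(b - z) else 0).
rewrite -(big_mkord predT F); have [le_ab|lt_ba] := leqP a b; last first.
  rewrite big1 // => z _; rewrite /F /gap_weight.
  by case: leqP => [le_az|]; rewrite ?mul0r // leqNgt (leq_trans lt_ba le_az) mulr0.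
have lowF0 : \sum_(0 <= z < a) F z = 0.
  rewrite big_nat big1 // => z /andP[_ lt_za].
  by rewrite /F /gap_weight leqNgt lt_za mul0r.
have highF0 : \sum_(b.+1 <= z < n.+1) F z = 0.
  rewrite big_nat big1 // => z /andP[lt_bz _].
  by rewrite /F [(z <= b)%N]leqNgt lt_bz mulr0.
rewrite (@big_cat_nat _ _ _ a) //=; last by rewrite ltnW.
rewrite (@big_cat_nat _ _ _ b.+1 a) //=; last by rewrite ltnW.
rewrite lowF0 highF0 add0r addr0.
rewrite -{1}[a : nat]add0n big_addn subSn // big_mkord exprS coefM.
apply: eq_bigr => i _; have le_iab : (i + a <= b)%N.
  by have := ltn_ord i; lia.
rewrite /F /gap_weight leq_addl addnK le_iab coef_poly ifT; last first.
  by have := ltn_ord b; lia.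
by congr (_ * _`_ _); lia.
Qed.

(** * Cyclic gaps *)

Lemma sum_window (R : comNzRingType) (n : nat) (phi : nat -> R) :
  \sum_(a < n) \sum_(b < n) (if (a <= b)%N then phi (b - a)%N else 0) =
  \sum_(d < n) phi d *+ (n - d).
Proof.
rewrite exchange_big /=; elim: n => [|n IHn]; first by rewrite !big_ord0.
transitivity (\sum_(d < n) phi d *+ (n - d) + \sum_(d < n.+1) phi d).
  rewrite big_ord_recr /= -IHn; congr (_ + _).
    apply: eq_bigr => b _; rewrite big_ord_recr /= leqNgt ltn_ord addr0.
    by [].
  rewrite [RHS](reindex_inj rev_ord_inj); apply: eq_bigr => a _ /=.
  by rewrite -ltnS ltn_ord subSS.
rewrite [RHS]big_ord_recr /= subSn // subnn mulr1n big_ord_recr /= addrA.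
congr (_ + _); rewrite -big_split; apply: eq_bigr => d _.
by rewrite subSn ?(ltnW (ltn_ord d)) // mulrSr.
Qed.

(* A cyclic gap of length e occurs in exactly e positions across the cut, hence
   the derivative. *)
Lemma sum_cyclic_gaps (R : comNzRingType) (n N : nat) (g : nat -> R)
    (H : {poly R}) :
  (n < N)%N ->
  \sum_(a < n.+1) \sum_(b < n.+1)
     g (a + n.+1 - b)%N * (if (a <= b)%N then H`_(b - a) else 0) =
  ((gap_poly N g)^`() * H)`_n.
Proof.
move=> lt_nN.
pose phi d := g (n.+1 - d)%N * H`_d.
transitivity (\sum_(d < n.+1) phi d *+ (n.+1 - d)).
  rewrite -sum_window; apply: eq_bigr => a _; apply: eq_bigr => b _.
  case: leqP => [le_ab|]; rewrite ?mulr0 // /phi; congr (g _ * _).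
  have := ltn_ord b; lia.
rewrite coefMr; apply: eq_bigr => d _; rewrite coef_deriv coef_poly /phi.
have le_dn : (d <= n)%N by rewrite -ltnS.
rewrite -subSn // ifT; last by lia.
by rewrite mulrnAl.
Qed.

(** * Low coefficients and the linear recurrence for the sum over [k] *)

Lemma coefM_low (R : comNzRingType) (p q : {poly R}) (n d : nat) :
  p`_0 = 0 -> (forall j, (j < d)%N -> q`_j = 0) -> (n <= d)%N ->
  (p * q)`_n = 0.
Proof.
move=> p0 q0 le_nd; rewrite coefM big1 // => -[[|j] lt_jn] _ /=.
  by rewrite p0 mul0r.
by rewrite q0 ?mulr0 //; lia.
Qed.

Lemma coef_expXM_low (R : comNzRingType) (p q : {poly R}) (c k j : nat) :
  p = 'X^c * q -> (j < c * k)%N -> (p ^+ k)`_j = 0.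
Proof. by move=> -> lt_jk; rewrite exprMn -exprM coefXnM lt_jk. Qed.

Lemma gap_poly_X (R : comNzRingType) (n : nat) (g : nat -> R) :
  g 0%N = 0 -> gap_poly n g = 'X^1 * \poly_(e < n) g e.+1.
Proof.
move=> g0; apply/polyP => -[|j]; rewrite coefXnM [LHS]coef_poly /= ?g0 //.
by rewrite coef_poly subn1 ltnS.
Qed.

Lemma gap_poly_X2 (R : comNzRingType) (n : nat) (g : nat -> R) :
  g 0%N = 0 -> g 1%N = 0 -> gap_poly n.+1 g = 'X^2 * \poly_(e < n) g e.+2.
Proof.
move=> g0 g1; apply/polyP => -[|[|j]]; rewrite coefXnM [LHS]coef_poly /= ?g0 ?g1 //.
by rewrite coef_poly subn2 !ltnS.
Qed.

(* Modulo X^(n+2), the hypothesis on T reads X G' = T (1 - G). *)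
Lemma sum_cyclic_coef (R : comNzRingType) (n : nat) (g T : nat -> R) :
  g 0%N = 0 ->
  (forall j, T j.+1 = g j.+1 *+ j.+1 + \sum_(e < j.+1) g e * T (j.+1 - e)%N) ->
  let G := gap_poly n.+1 g in
  \sum_(k < n.+1) (G^`() * G ^+ k)`_n = T n.+1.
Proof.
move=> g0 TE G.
(* The constant term is set to 0 because the recurrence constrains [T] only at positive indices. *)
pose Tp := \poly_(j < n.+2) (if j is 0 then 0 else T j).
pose E := 'X * G^`() - Tp * (1 - G).
have E0 j : (j <= n.+1)%N -> E`_j = 0.
  case: j => [|j] le_jn.
    rewrite /E coefB coefXM mulrBr mulr1 coefB coefM big_ord1 /= !coef_poly /=.
    by rewrite mul0r !subrr.
  rewrite ltnS in le_jn.
  have TpG : (Tp * G)`_j.+1 = \sum_(e < j.+1) g e * T (j.+1 - e)%N.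
    rewrite coefMr big_ord_recr /= subnn coef_poly mul0r addr0.
    apply: eq_bigr => -[e /= lt_ej] _; rewrite !coef_poly !ifT; try lia.
    by rewrite mulrC subSn.
  rewrite /E mulrBr mulr1 !coefB TpG coefXM /= coef_deriv !coef_poly !ltnS.
  by rewrite le_jn TE addrK subrr.
(* The truncated geometric series inverts [1 - G] up to [G ^+ n.+1]. The error [Tp * G ^+ n.+1]
   starts in degree [n + 2], as [Tp] and [G] have no constant term. *)
pose S := \sum_(k < n.+1) G ^+ k.
transitivity (('X * G^`() * S)`_n.+1).
  rewrite mulr_sumr coef_sum; apply: eq_bigr => k _.
  by rewrite -mulrA coefXM.
have -> : 'X * G^`() * S = E * S + Tp - Tp * G ^+ n.+1.
  have GS : (1 - G) * S = 1 - G ^+ n.+1.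
    by apply: oppr_inj; rewrite -mulNr !opprB -subrX1.
  have -> : 'X * G^`() = E + Tp * (1 - G) by rewrite subrK.
  by rewrite mulrDl -(mulrA Tp) GS mulrBr mulr1 addrA.
rewrite coefB coefD [X in _ - X](@coefM_low _ _ _ _ n.+1) //; last first.
- by move=> j lt_jn; apply: (coef_expXM_low (gap_poly_X _ g0)); rewrite mul1n.
- by rewrite coef_poly.
rewrite [(E * S)`_ _]coefM big1 ?add0r ?subr0 => [|j _].
  by rewrite coef_poly ltnSn.
by rewrite E0 ?mul0r // -ltnS.
Qed.

(* The weight of a gap in v^{k,1}, at y = m - 3. *)
Definition gap_colorings (y : int) (d : nat) : int :=
  if (1 < d)%N then (y + 1) * y ^+ (d - 2) else 0.

(** For the full series, [1 - G = (1 - (y + 1) X) (1 + X) / (1 - y X)]; [T] lists the coefficients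
    of [X G' / (1 - G)], which is [- X] times the logarithmic derivative of [1 - G]. *)
Lemma gap_colorings_rec (y : int) (j : nat) :
  let T i : int := (y + 1) ^+ i + (-1) ^+ i - y ^+ i in
  T j.+1 = gap_colorings y j.+1 *+ j.+1
           + \sum_(e < j.+1) gap_colorings y e * T (j.+1 - e)%N.
Proof.
move=> T; case: j => [|j].
  by rewrite big_ord1 /gap_colorings /T /= !expr1; ring.
rewrite -(big_mkord predT (fun e => gap_colorings y e * T (j.+2 - e)%N)).
rewrite !big_nat_recl //= /gap_colorings /= !mul0r !add0r big_mkord.
have -> : \sum_(i < j) (y + 1) * y ^+ (i.+2 - 2) * T (j.+2 - i.+2)%N =
    T j.+2 - j.+2%:R * ((y + 1) * y ^+ j).
  under eq_bigr do rewrite !subSS subn0.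
  (* The weights are geometric: without its first term the sum is [y] times the sum for [j]. *)
  elim: j => [|j IHj]; first by rewrite big_ord0 /T !exprS expr0; ring.
  rewrite big_ord_recl /= subn0 expr0.
  rewrite (eq_bigr (fun i : 'I_j => y * ((y + 1) * y ^+ i * T (j - i)%N))).
    rewrite -mulr_sumr IHj -[j.+3%:R]natr1 /T !exprS; ring.
  move=> i _; rewrite /bump /= add1n subSS exprS; ring.
rewrite -mulr_natl !subSS subn0; ring.
Qed.

(* The weight of a gap in t_{n,x}^k, at x = r + 2; it vanishes at the excluded
   gap 2 because lucas _ _ 0 = 0. *)
Definition gap_walks (r : int) (d : nat) : int :=
  if d is e.+2 then 2 * r * lucas (r - 1) (2 * r) e else d%:R.

(** With [D = 1 - (r - 1) X - 2 r X^2], the full series satisfies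
    [1 - G = (1 - (r + 1) X) (1 + X) / D]. The logarithmic derivative gives [T];
    [2 u_{i+1} - (r - 1) u_i] is the companion Lucas sequence coming from [D]. *)
Lemma gap_walks_rec (r : int) (j : nat) :
  let u := lucas (r - 1) (2 * r) in
  let T i : int := (r + 1) ^+ i + (-1) ^+ i - (2 * u i.+1 - (r - 1) * u i) in
  T j.+1 = gap_walks r j.+1 *+ j.+1
           + \sum_(e < j.+1) gap_walks r e * T (j.+1 - e)%N.
Proof.
move=> u T; case: j => [|j].
  by rewrite big_ord1 /gap_walks /T /u /=; ring.
rewrite -(big_mkord predT (fun e => gap_walks r e * T (j.+2 - e)%N)).
rewrite !big_nat_recl //= !mul0r !add0r mul1r subn1 /= big_mkord.
under eq_bigr do rewrite -mulrA subSS subSS.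
rewrite -mulr_sumr.
(* The convolution of [u] and [T] inherits the recurrence of [u] with source term [T]; being of
   second order, it is solved by carrying two consecutive values. *)
pose Q j := \sum_(i < j) u i * T (j - i)%N.
have QSS i : Q i.+2 = T i.+1 + (r - 1) * Q i.+1 + 2 * r * Q i.
  rewrite /Q 2!big_ord_recl [in RHS]big_ord_recl /= /bump /= !mul0r !add0r mul1r.
  rewrite subn1 /= -[RHS]addrA !mulr_sumr -big_split /=; congr (_ + _).
  apply: eq_bigr => e _; rewrite !add1n !subSS /u lucasSS; ring.
have [-> _] : 2 * r * Q j = T j.+2 - T j.+1 - 2 * r * j.+2%:R * u j /\
    2 * r * Q j.+1 = T j.+3 - T j.+2 - 2 * r * j.+3%:R * u j.+1.
  elim: j => [|j [IH1 IH2]].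
    by rewrite /Q big_ord0 big_ord1 /T /u /=; split; ring.
  have lin (a b c : int) : 2 * r * (a + (r - 1) * b + 2 * r * c) =
      2 * r * a + (r - 1) * (2 * r * b) + 2 * r * (2 * r * c) by ring.
  split=> //; rewrite QSS lin IH1 IH2 /T /u !lucasSS.
  rewrite -[j.+4%:R]natr1 -[j.+3%:R]natr1 !exprS; ring.
rewrite -mulr_natl; ring.
Qed.

(** * Summing [t_nk] and [v1_nk] over [k] *)

(** [seq_sum] allows one value more than there are cyclic positions. Here the top value is excluded,
    as in [t_nk]; [sum_window_high] excludes 0, as in [v1_nk]. *)
Lemma sum_window_low (R : comNzRingType) (n : nat) (g : nat -> R)
    (H : {poly R}) :
  \sum_(a < n.+2) \sum_(b < n.+2) (if (b < n.+1)%N then g (a + n.+1 - b)%N else 0)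
     * (if (a <= b)%N then H`_(b - a) else 0) =
  ((gap_poly n.+1 g)^`() * H)`_n.
Proof.
rewrite -(@sum_cyclic_gaps _ n) // big_ord_recr /= [X in _ + X]big1 ?addr0.
  apply: eq_bigr => a _; rewrite big_ord_recr /= ltnn mul0r addr0.
  by apply: eq_bigr => b _; rewrite ltn_ord.
by move=> b _; case: ltnP; rewrite ?mul0r ?mulr0.
Qed.

Lemma sum_window_high (R : comNzRingType) (n : nat) (g : nat -> R)
    (H : {poly R}) :
  \sum_(a < n.+2) \sum_(b < n.+2) (if (0 < a)%N then g (a + n.+1 - b)%N else 0)
     * (if (a <= b)%N then H`_(b - a) else 0) =
  ((gap_poly n.+1 g)^`() * H)`_n.
Proof.
rewrite -(@sum_cyclic_gaps _ n) // big_ord_recl /= big1 ?add0r => [|b _]; last first.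
  by rewrite mul0r.
apply: eq_bigr => a _; rewrite big_ord_recl /= mulr0 add0r.
by apply: eq_bigr => b _; rewrite /bump !add1n addSn !subSS ltnS.
Qed.

Lemma gap_walks_p_poly (r : int) (d : nat) : (2 < d)%N ->
  gap_walks r d = 2 * (p_poly (d - 2)).[r + 2].
Proof.
case: d => [|[|[|d]]] // _; rewrite /= subSS subSS subn0 horner_p_poly.
have -> : r + 2 - 2 = r by ring.
have -> : r + 2 - 3 = r - 1 by ring.
by rewrite mulrA.
Qed.

(** The four sums split the wrap-around gap [a + n.+1 - b] by whether the extreme positions 0 and
    [n] are occupied. The end pairs they omit have gap 2, where the weight vanishes. *)
Lemma t_nk_coef (n k : nat) (r : int) : (k.+1 < n)%N ->
  let G := gap_poly n.+1 (gap_walks r) in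
  t_nk n.+1 k.+1 (r + 2) = (G^`() * G ^+ k)`_n.
Proof.
move=> lt_kn G; rewrite /t_nk /= eqSS ltn_eqF 1?ltnW //.
rewrite ltn_eqF // [(n.+1 - 1)%N]subn1 /=.
pose g := gap_walks r.
(* The product in [t_nk] skips gaps of length at most 2, hence the factor 1. *)
pose wt d : int := if (2 < d)%N then 2 * (p_poly (d - 2)).[r + 2] else 1.
have gE d : g d = if (0 < d)%N && (d != 2)%N then wt d else 0.
  rewrite /wt; case: d => [|[|[|d]]] //; first by rewrite /g /= mulr0.
  exact: (@gap_walks_p_poly r d.+3).
rewrite (@seq_sum_walk _ _ _ (fun a b => (a == 0) && (b == n))%N
          (fun _ _ => 1) wt g _ _ gE) //; last first.
  by move=> i; rewrite mul1r big_mkcond.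
rewrite (@seq_sum_walk _ _ _ (fun a b => (a == 0) && (b < n.+1 - 2))%N
  (fun a b => 2 * (p_poly (n.+1 - b - 2)).[r + 2]) wt g _ _ gE) //; last first.
  by move=> i; rewrite big_mkcond mulrC.
rewrite (@seq_sum_walk _ _ _ (fun a b => (1 < a) && (b == n))%N
  (fun a b => 2 * (p_poly (a - 1)).[r + 2]) wt g _ _ gE) //; last first.
  by move=> i; rewrite big_mkcond.
rewrite (@seq_sum_walk _ _ _ (fun a b => (0 < a) && (b < n))%N
  (fun a b => 2 * (p_poly (a + n.+1 - b - 2)).[r + 2]) wt g _ _ gE) //; last first.
  by move=> i; rewrite big_mkcond.
rewrite -sum_window_low -!big_split /=; apply: eq_bigr => a _.
rewrite -!big_split /=; apply: eq_bigr => b _.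
rewrite -walk_gap_weight -!mulrDl; congr (_ * _).
case: a b => a _ [b _] /=; rewrite -/g ltnS.
have [lt_bn|lt_nb|->] := ltngtP b n; rewrite ?andbF ?andbT ?addr0 //.
- case: a => [|a] /=; last by rewrite !add0r /g gap_walks_p_poly //; lia.
  rewrite addr0 add0r /g.
  have [lt_b|le_b] := ltnP b (n.+1 - 2); first by rewrite gap_walks_p_poly //; lia.
  by rewrite -/g gE ifF //; lia.
- by rewrite add0r ifF //; lia.
have -> : (n < n.+1 - 2)%N = false by lia.
rewrite andbF addr0 /g.
case: a => [|[|a]] /=; first by rewrite addr0 add0n subSnn.
  by rewrite addr0 add1n subSn // subSnn.
by rewrite add0r addnS -addSn addnK gap_walks_p_poly.
Qed.

(** At the two top indices the coefficients are 0 and 1, whereas [t_nk] is 0 and [1 + (-1) ^+ n.+3];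
    this produces the last sign term. *)
Lemma sum_t_nk (n : nat) (r : int) :
  let u := lucas (r - 1) (2 * r) in
  \sum_(1 <= k < n.+4) t_nk n.+3 k (r + 2) =
  (r + 1) ^+ n.+3 + (-1) ^+ n.+3 - (2 * u n.+4 - (r - 1) * u n.+3)
  + (-1) ^+ n.+3.
Proof.
move=> u; pose G := gap_poly n.+3 (gap_walks r).
have g0 : gap_walks r 0 = 0 by [].
have := @sum_cyclic_coef _ n.+2 (gap_walks r) _ g0 (gap_walks_rec r).
rewrite /= -/u => <-; rewrite -/G big_add1 /= !big_mkord.
have GX := gap_poly_X n.+3 g0; rewrite -/G in GX.
pose K := \poly_(e < n.+3) gap_walks r e.+1; rewrite -/K in GX.
have coefK k : (K ^+ k)`_0 = 1 /\ (K ^+ k)`_1 = 0.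
  elim: k => [|k [IH0 IH1]]; first by rewrite expr0 !coef1.
  rewrite exprS !coefM !big_ord_recl !big_ord0 /= IH0 IH1 /K !coef_poly /=.
  by rewrite !mulr0 !mul0r !addr0 mul1r.
(* G = X (1 + O(X^2)), since g(1) = 1 and g(2) = 0. *)
have topcoef k : (G^`() * G ^+ k)`_k = 1 /\ (G^`() * G ^+ k)`_k.+1 = 0.
  have [K0 K1] := coefK k.
  have -> : G^`() * G ^+ k = 'X^k * (G^`() * K ^+ k).
    by rewrite {2}GX exprMn expr1 mulrCA.
  rewrite !coefXnM ltnn subnn subSnn ltnNge leqnSn /= !coefM !big_ord_recl !big_ord0 /=.
  rewrite K0 K1 !coef_deriv !coef_poly /=.
  by rewrite !(mulr0, mul0rn, mul0r, addr0, mulr1n, mul1r).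
rewrite [LHS]big_ord_recr [in RHS]big_ord_recr /=.
rewrite [X in X + _]big_ord_recr [X in _ = X + _ + _]big_ord_recr /=.
rewrite (topcoef n.+2).1 (topcoef n.+1).2 !addr0.
have -> : t_nk n.+3 n.+2 (r + 2) = 0 by rewrite /t_nk /= ltn_eqF // eqxx.
have -> : t_nk n.+3 n.+3 (r + 2) = 1 + (-1) ^+ n.+3.
  by rewrite /t_nk eqxx -signr_odd; case: odd.
rewrite addr0 addrA; congr (_ + _ + _).
by apply: eq_bigr => k _; rewrite -t_nk_coef // ltnS.
Qed.

(** The three sums split the wrap-around gap by its ends; the omitted pair has gap 1 and weight 0.
    Beyond [n.+1./2] the coefficient vanishes too, because [G] is divisible by [X^2]. *)
Lemma v1_nk_coef (n k : nat) (y : int) : 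
  let G := gap_poly n.+1 (gap_colorings y) in
  v1_nk n.+1 k.+1 (y + 3) = 2 * (G^`() * G ^+ k)`_n.
Proof.
move=> G; pose g := gap_colorings y.
have y1 : y + 3 - 2 = y + 1 by ring.
have y0 : y + 3 - 3 = y by ring.
rewrite /v1_nk y1 y0; have [le_kn|lt_nk] := leqP k.+1 n.+1./2; last first.
  have G2 : G = 'X^2 * \poly_(e < n) g e.+2 by apply: gap_poly_X2.
  suff -> : (G^`() * G ^+ k)`_n = 0 by rewrite mulr0.
  apply: (@coefM_low _ _ _ _ (2 * k)%N).
  - by rewrite coef_deriv coef_poly mulr1n.
  - by move=> j; apply: coef_expXM_low G2.
  by rewrite -divn2 in lt_nk; lia.
pose wt d : int := (y + 1) * y ^+ (d - 2).
have gE d : g d = if (0 < d)%N && (1 < d)%N then wt d else 0.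
  by rewrite /g /gap_colorings /wt; case: d => [|[|d]].
rewrite (@seq_sum_walk _ _ _ (fun a b => (1 < a) && (b == n.+1))%N
          (fun a _ => (y + 1) * y ^+ (a - 2)) wt g _ _ gE) //.
rewrite (@seq_sum_walk _ _ _ (fun a b => (a == 1) && (b < n.+1))%N
          (fun _ b => (y + 1) * y ^+ (n.+1 - b - 1)) wt g _ _ gE) //; last first.
  by move=> i; rewrite mulrC.
rewrite (@seq_sum_walk _ _ _ (fun a b => (1 < a) && (b < n.+1))%N
          (fun a b => (y + 1) * y ^+ (a + n.+1 - b - 2)) wt g _ _ gE) //.
rewrite -!mulrDr; congr (2 * _).
rewrite -sum_window_high -!big_split /=; apply: eq_bigr => a _.
rewrite -!big_split /=; apply: eq_bigr => b _.
rewrite -walk_gap_weight -!mulrDl; congr (_ * _).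
case: a b => a _ [b] /=; rewrite ltnS leq_eqVlt -/g => /predU1P[->|lt_bn].
  rewrite eqxx ltnn !andbF !addr0 andbT addnK.
  by rewrite /g /gap_colorings; case: a => [|[|a]].
rewrite ltn_eqF // lt_bn andbF !andbT add0r /g /gap_colorings.
case: a => [|[|a]] /=; first by [].
  rewrite addr0 ifT; last by lia.
  by congr (_ * _ ^+ _); lia.
by rewrite add0r ifT //; lia.
Qed.

Lemma sum_v1_nk (n : nat) (y : int) :
  \sum_(1 <= k < n.+2) v1_nk n.+1 k (y + 3) =
  2 * ((y + 1) ^+ n.+1 + (-1) ^+ n.+1 - y ^+ n.+1).
Proof.
have g0 : gap_colorings y 0 = 0 by [].
rewrite -(@sum_cyclic_coef _ n (gap_colorings y) _ g0 (gap_colorings_rec y)).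
rewrite mulr_sumr big_add1 big_mkord; apply: eq_bigr => k _.
exact: v1_nk_coef.
Qed.

(** * Comparing the two closed forms *)

Lemma lucas0 (R : comNzRingType) (a : R) (n : nat) : lucas a 0 n.+1 = a ^+ n.
Proof.
elim: n => [|n IHn]; first by rewrite expr0.
by rewrite lucasSS IHn mul0r addr0 exprS.
Qed.

Theorem proposition10 (n m : nat) (hn : (3 <= n)%N) (hm : (3 <= m)%N) :
  (hom_count (wheel n) (quasi_complete m))%:Z =
    m%:Z * (m%:Z - 2) * ((m%:Z - 2) ^+ (n - 1) + (-1) ^+ n)
    - \sum_(1 <= k < n.+1) v_nk n k m%:Z.
Proof.
case: n hn => [|[|[|n]]] // hn; case: m hm => [|[|[|m]]] // _.
have := hom_count_wheel_quasi_complete m hn; cbv zeta beta => ->.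
have -> : m.+3%:Z = m%:Z + 3 by lia.
set y := m%:Z.
have -> : \sum_(1 <= k < n.+4) v_nk n.+3 k (y + 3) =
    \sum_(1 <= k < n.+4) v0_nk n.+3 k (y + 3)
    + \sum_(1 <= k < n.+4) v1_nk n.+3 k (y + 3) by rewrite -big_split.
rewrite sum_v1_nk /v0_nk -mulr_sumr.
have -> : y + 3 - 1 = y + 2 by ring.
have -> : y + 3 - 2 = y + 1 by ring.
(* For the ends of the missing edge [p = 0], so their Lucas sequence consists of powers of [y]. All
   other Lucas terms on both sides belong to [lucas (y - 1) (2 * y)] and reduce to two consecutive
   ones. *)
rewrite sum_t_nk [(n.+3 - 1)%N]subn1 [n.+3.-1]/= addrK !mul0r lucas0.
rewrite !lucasSS !exprS; ring.
Qed.
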